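(* For every partition $\lambda$ in the $C_n$ theory, the new definition of the symbol of $\lambda$ is equivalent to the old definition: the two procedures produce the same symbol (the same top row and the same bottom row).
   Context: A partition in the $C_n$ theory is a partition $\lambda=(\lambda_1\ge\cdots\ge\lambda_l\ge1)$ of $2n$ in which every odd integer occurs an even number of times; $l$ is its length. For a sequence $\mu=(\mu_1\ge\cdots\ge\mu_L\ge0)$, form the numbers $L-k+\mu_k$ ($1\le k\le L$), list the odd ones increasingly as $2f_1+1<2f_2+1<\cdots$ and the even ones increasingly as $2g_1<2g_2<\cdots$, and set $A_i=f_i-i+1$, $B_i=g_i-i+1$. A symbol is a two-row array with top row $(\alpha_1,\alpha_2,\dots)$ and bottom row $(\beta_1,\beta_2,\dots)$. The ''$B_n$ procedure'' applied to $\mu$ puts $\alpha_i=A_i$, $\beta_i=B_i$. Old definition ($C_n$): if $l$ is even, let $\mu=(\lambda,0)$ ($\lambda$ with an extra part $0$ appended); if $l$ is odd, let $\mu=\lambda$. The symbol has $\alpha_i=B_i=g_i-i+1$ and $\beta_i=A_i=f_i-i+1$ computed from $\mu$. New definition ($C_n$): if $l$ is even, apply the $B_n$ procedure to $\mu=\lambda$ and then insert an extra $0$ at the left end of the top row. If $l$ is odd, apply the $B_n$ procedure to $\mu=(\lambda,0)$ and then delete the first entry of the bottom row, which is $0$. *)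

(* Defs.v *)
From mathcomp Require Import all_boot all_order all_algebra.

Set Implicit Arguments.
Unset Strict Implicit.
Unset Printing Implicit Defensive.

Import GRing.Theory.

Definition partition_C (n : nat) (lam : seq nat) : Prop :=
  [/\ sorted geq lam,
      all (leq 1) lam,
      sumn lam = n.*2
    & forall m : nat, odd m -> ~~ odd (count_mem m lam)].

(* Sequences are indexed from 0, so mu_k is nth 0 mu k.-1; the truncated
   subtraction is exact because k <= L. *)
Definition shifted (mu : seq nat) : seq nat :=
  [seq size mu - k + nth 0 mu k.-1 | k <- iota 1 (size mu)].

(* Halving sends both 2 f + 1 to f and 2 g to g. *)
Definition f_seq (mu : seq nat) : seq nat :=
  [seq x./2 | x <- sort leq [seq x <- shifted mu | odd x]].

Definition g_seq (mu : seq nat) : seq nat :=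
  [seq x./2 | x <- sort leq [seq x <- shifted mu | ~~ odd x]].

(* The sequence s_i - i + 1, for i = 1, ..., size s, computed in int so that
   no truncation occurs. *)
Definition reduce (s : seq nat) : seq int :=
  [seq ((nth 0 s i.-1)%:Z - i%:Z + 1)%R | i <- iota 1 (size s)].

Definition A_seq (mu : seq nat) : seq int := reduce (f_seq mu).
Definition B_seq (mu : seq nat) : seq int := reduce (g_seq mu).

Record symbol := Symbol { top_row : seq int; bottom_row : seq int }.

Definition procedure_B (mu : seq nat) : symbol := Symbol (A_seq mu) (B_seq mu).

Definition old_symbol_C (lam : seq nat) : symbol :=
  let mu := if odd (size lam) then lam else rcons lam 0 in
  Symbol (B_seq mu) (A_seq mu).

(* The entry removed by behead is 0: see B_seq_rcons0. *)
Definition new_symbol_C (lam : seq nat) : symbol :=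
  if odd (size lam) then
    let s := procedure_B (rcons lam 0) in
    Symbol (top_row s) (behead (bottom_row s))
  else
    let s := procedure_B lam in
    Symbol (0%R :: top_row s) (bottom_row s).

Lemma B_seq_rcons0 (lam : seq nat) :
  B_seq (rcons lam 0) = 0%R :: behead (B_seq (rcons lam 0)).
Proof.
have h0 : 0 \in sort leq [seq x <- shifted (rcons lam 0) | ~~ odd x].
  rewrite mem_sort mem_filter /=; apply/mapP; exists (size lam).+1.
    by rewrite mem_iota size_rcons add1n ltnS leqnn.
  by rewrite size_rcons subnn nth_rcons ltnn eqxx.
have := sort_sorted leq_total [seq x <- shifted (rcons lam 0) | ~~ odd x].
rewrite /B_seq /reduce /g_seq; case: (sort _ _) h0 => // a s h0 hs.
suff -> : a = 0 by rewrite /= sub0r addNr.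
move: h0; rewrite inE => /orP[/eqP // | h0].
have /allP/(_ 0 h0) := order_path_min leq_trans hs.
by rewrite leqn0 => /eqP.
Qed.

(* Main.v *)
(** Appending a part 0 to [lam] adds 1 to every number [L - k + lam_k] and
    creates a new number 0. Hence odd and even numbers are exchanged: each even
    [2 g] becomes the odd [2 g + 1], and each odd [2 f + 1] becomes the even
    [2 (f + 1)], which moves one place to the right behind the new 0, so that
    the shift by [i] absorbs the increment. So [A] of [(lam, 0)] is [B] of
    [lam], and [B] of [(lam, 0)] is [A] of [lam] with a 0 in front. *)
Require Import Defs.
From mathcomp Require Import all_boot all_order all_algebra.

Set Implicit Arguments.
Unset Strict Implicit.
Unset Printing Implicit Defensive.

Lemma shifted_rcons0 (mu : seq nat) :
  shifted (rcons mu 0) = rcons (map S (shifted mu)) 0.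
Proof.
rewrite /shifted size_rcons -(addn1 (size mu)) iotaD map_cat cats1 /= add1n addn1.
rewrite subnn nth_rcons ltnn eqxx; congr rcons.
rewrite -map_comp; apply/eq_in_map => k.
rewrite mem_iota add1n ltnS => /andP[k1 kL].
(* [k <= L] makes the subtraction exact; [0 < k] keeps [k.-1] inside [mu]. *)
by rewrite /= subSn // nth_rcons prednK // kL addSn.
Qed.

Lemma sort_leq_rcons0 (s : seq nat) : sort leq (rcons s 0) = 0 :: sort leq s.
Proof.
apply: (sorted_eq leq_trans anti_leq); first exact: sort_sorted leq_total _.
  rewrite /= (path_sortedE leq_trans) sort_sorted ?andbT; last exact: leq_total.
  exact/allP.
by rewrite perm_sort perm_rcons perm_cons perm_sym perm_sort.
Qed.

Lemma sort_leq_mapS (s : seq nat) : sort leq (map S s) = map S (sort leq s).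
Proof. by rewrite sort_map. Qed.

Lemma f_seq_rcons0 (mu : seq nat) : f_seq (rcons mu 0) = g_seq mu.
Proof.
rewrite /f_seq /g_seq shifted_rcons0 filter_rcons /= filter_map sort_leq_mapS.
rewrite -map_comp; apply/eq_in_map => x.
(* For even [x], [x] and [x + 1] have the same half. *)
by rewrite mem_sort mem_filter /= => /andP[xe _]; rewrite uphalf_half (negPf xe).
Qed.

Lemma g_seq_rcons0 (mu : seq nat) : g_seq (rcons mu 0) = 0 :: map S (f_seq mu).
Proof.
rewrite /f_seq /g_seq shifted_rcons0 filter_rcons /= filter_map sort_leq_rcons0.
rewrite sort_leq_mapS /= -!map_comp; congr cons.
rewrite (eq_filter (a2 := odd)) => [|x]; last by rewrite /= negbK.
apply/eq_in_map => x.
(* For odd [x], passing to [x + 1] raises the half by 1. *)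
by rewrite mem_sort mem_filter /= => /andP[xo _]; rewrite uphalf_half xo.
Qed.

Lemma reduce_cons0_mapS (s : seq nat) : reduce (0 :: map S s) = 0%R :: reduce s.
Proof.
rewrite /reduce /= size_map; congr cons.
(* Indices past the leading 0 are those of [s] shifted by 1. *)
rewrite -[2]/(1 + 1) iotaDl -map_comp; apply/eq_in_map => -[|i].
  by rewrite mem_iota.
rewrite mem_iota add1n ltnS => /andP[_ iL] /=.
(* [m.+1%:Z - i.+2%:Z] and [m%:Z - i.+1%:Z] are convertible. *)
by rewrite (nth_map 0).
Qed.

Lemma A_seq_rcons0 (mu : seq nat) : A_seq (rcons mu 0) = B_seq mu.
Proof. by rewrite /A_seq f_seq_rcons0. Qed.

Lemma B_seq_rcons0_A_seq (mu : seq nat) :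
  B_seq (rcons mu 0) = 0%R :: A_seq mu.
Proof. by rewrite /B_seq g_seq_rcons0 reduce_cons0_mapS. Qed.

Theorem proposition2 (n : nat) (lam : seq nat) (hlam : partition_C n lam) :
  new_symbol_C lam = old_symbol_C lam.
Proof.
rewrite /new_symbol_C /old_symbol_C /=.
(* The 0 is appended on the new side for odd length, on the old side for even length. *)
by case: ifP => _; rewrite A_seq_rcons0 B_seq_rcons0_A_seq.
Qed.
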